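(* For all $p\in(1/2,1)$ and $0\le\lambda\le1$, $$\mu_p(\lambda)\ge 2-\sqrt{1-(1-p)(1+\lambda^2)+\lambda^2(1-p)^2}.$$
   Context: Consider Bernoulli bond percolation on the nearest-neighbour graph $\mathbb{Z}^2$: each edge is independently open with probability $p\in(0,1)$ and closed with probability $1-p$. Write $v\leftrightarrow w$ if $v,w\in\mathbb{Z}^2$ are in the same connected component of the graph of open edges, and $v\leftrightarrow\infty$ if $v$ is in the infinite connected component. $D(v,w)$ is the minimal number of edges of an open path from $v$ to $w$. $\mathbf{0}=(0,0)$. For $z\in\mathbb{R}^2$, $[z]$ denotes one of the lattice points of $\mathbb{Z}^2$ closest to $z$. The number $\mu_p(\lambda)$ is the deterministic constant such that, almost surely on the event $\{\mathbf{0}\leftrightarrow\infty\}$, $$\mu_p(\lambda)=\lim_{\substack{n\to\infty\\ \mathbf{0}\leftrightarrow[n(1,\lambda(1-p))]}}\frac{D\left(\mathbf{0},[n(1,\lambda(1-p))]\right)}{n},$$ the limit being along the (random) subsequence of $n$ such that $\mathbf{0}\leftrightarrow[n(1,\lambda(1-p))]$; its existence is a known result of Garet and Marchand. *)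

(* Defs.v *)
From HB Require Import structures.
From mathcomp Require Import all_boot all_order all_algebra.
From mathcomp Require Import all_classical all_reals all_analysis.
Import Order.TTheory GRing.Theory Num.Theory.
Import numFieldNormedType.Exports.

Set Implicit Arguments.
Unset Strict Implicit.
Unset Printing Implicit Defensive.

Local Open Scope classical_set_scope.
Local Open Scope ring_scope.

Definition vertex : Type := (int * int)%type.

(* Every undirected nearest-neighbour edge is represented exactly once:
   (v, false) joins v to v + (1, 0), and (v, true) joins v to v + (0, 1). *)
Definition edge : Type := (vertex * bool)%type.

Definition edge_src (e : edge) : vertex := e.1.

Definition edge_tgt (e : edge) : vertex :=
  if e.2 then (e.1.1, e.1.2 + 1) else (e.1.1 + 1, e.1.2).

(* [c e] is true when the edge e is open. *)
Definition config : Type := edge -> bool.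

Definition open_adj (c : config) (v w : vertex) : bool :=
  `[< exists e : edge, c e /\
        ((edge_src e = v /\ edge_tgt e = w) \/
         (edge_src e = w /\ edge_tgt e = v)) >].

(* The path visits v and then the vertices of s, so it has [size s] edges. *)
Definition open_path (c : config) (v w : vertex) (s : seq vertex) : Prop :=
  path (open_adj c) v s /\ last v s = w.

Definition connected_to (c : config) (v w : vertex) : Prop :=
  exists s : seq vertex, open_path c v w s.

Definition connected_to_infinity (c : config) (v : vertex) : Prop :=
  infinite_set [set w | connected_to c v w].

Definition is_min_path_length (c : config) (v w : vertex) (k : nat) : Prop :=
  (exists2 s, open_path c v w s & size s = k) /\
  (forall s, open_path c v w s -> (k <= size s)%N).

(* The value is the junk 0 when v and w are not connected. *)
Definition chemical_distance (c : config) (v w : vertex) : nat :=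
  xget 0%N [set k | is_min_path_length c v w k].

Definition bernoulli_percolation (R : realType) (d : measure_display)
    (T : measurableType d) (P : probability T R) (p : R)
    (X : T -> config) : Prop :=
  [/\ forall e : edge, measurable [set t | X t e],
      forall e : edge, P [set t | X t e] = p%:E &
      forall J : seq edge, uniq J ->
        P [set t | forall e, e \in J -> X t e]
        = (\prod_(e <- J) P [set t | X t e])%E].

Definition euclidean_dist (R : realType) (x y : R * R) : R :=
  Num.sqrt ((x.1 - y.1) ^+ 2 + (x.2 - y.2) ^+ 2).

Definition lattice_point (R : realType) (v : vertex) : R * R :=
  (v.1%:~R, v.2%:~R).

Definition is_lattice_rounding (R : realType) (rd : R * R -> vertex) : Prop :=
  forall (z : R * R) (w : vertex),
    euclidean_dist z (lattice_point R (rd z))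
    <= euclidean_dist z (lattice_point R w).

Definition origin : vertex := (0, 0).

Definition target (R : realType) (rd : R * R -> vertex) (p lambda : R)
    (n : nat) : vertex :=
  rd (n%:R, n%:R * (lambda * (1 - p))).

(* A limit along a subsequence presupposes infinitely many indices; without
   this clause the convergence along [within] could hold vacuously. *)
Definition distance_limit (R : realType) (rd : R * R -> vertex) (p lambda : R)
    (c : config) (m : R) : Prop :=
  let N := [set n : nat | connected_to c origin (target rd p lambda n)] in
  infinite_set N /\
  (fun n : nat =>
     (chemical_distance c origin (target rd p lambda n))%:R / n%:R : R)
    @ within N \oo --> m.

(* [unique] expresses that mu is the only real number which is almost surely
   the limit on the event that the origin lies in an infinite cluster. *)
Definition is_time_constant (R : realType) (d : measure_display)
    (T : measurableType d) (P : probability T R) (X : T -> config)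
    (rd : R * R -> vertex) (p lambda mu : R) : Prop :=
  unique (fun m : R =>
    {ae P, forall t, connected_to_infinity (X t) origin ->
                     distance_limit rd p lambda (X t) m}) mu.

(* Main.v *)
Require Import Defs.
From HB Require Import structures.
From mathcomp Require Import all_boot all_order all_algebra.
From mathcomp Require Import all_classical all_reals all_analysis.
From mathcomp Require Import ring lra zify.
Import Order.TTheory GRing.Theory Num.Theory.
Import numFieldNormedType.Exports.
Local Open Scope classical_set_scope.
Local Open Scope ring_scope.

(** Write e = 1 - p. The idea is to bound the distance from below by the
increment of a random function on the lattice which is 1-Lipschitz along open
edges and whose increment between the two endpoints is explicit.

Such a function is v |-> v.1 + f(v), where f has vertical increments +1 or -1
and satisfies f(i+1,y) = f(i,y) whenever the horizontal edge from (i,y) to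
(i+1,y) is open. Over a closed edge f keeps its value, except that a corner
which is both below its upper neighbour in column i and below its lower
neighbour in column i+1 is raised by 2. In the sheared coordinates
(i, r) with r = y + i + constant this is a corner-growth rule on a quadrant:
the horizontal step F(i,r) - F(i+1,r) and the vertical step F(i,r+1) - F(i,r)
enter each cell, and are exchanged for the outgoing pair by [cell]. Hence f is
determined by its boundary steps, which may be chosen freely, and every choice
bounds the distance: this is [size_open_path_ge].

Now draw the boundary at random: vertical steps are +1 with probability a,
horizontal ones with probability a', all independent. When
a' (1 - a) = p a (1 - a') one cell preserves this product law
([expect_cell], a discrete Burke property), hence so does the whole grid, and
the horizontal steps along any row are independent again
([expect_outflow]). The increment of F between the endpoints is thus a
difference of two sums, each of independent signs, with mean about
n ((2a - 1)(1 + th) - (2a' - 1)) for the target (n, n th). Exponential moments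
show that a path shorter than n plus this mean, by a margin linear in n, exists
with exponentially small probability ([rare_short_paths]), and by
Borel-Cantelli only finitely many n admit one. With the choice of a made in
[optimal_densities], n plus this mean is at least n times the stated bound.

That the origin percolates with positive probability comes for free: if
it did not, every real number would be a limit almost surely on that event,
against the uniqueness in the definition of the time constant. *)

(** * Expectations over finitely many independent bits *)

Definition expect1 {R : realType} (a : R) (F : bool -> R) : R :=
  a * F true + (1 - a) * F false.

(** Bits are lists rather than functions on a finite type, so that independence
of blocks is concatenation ([expect_cat]) and the grid can be processed by
structural recursion. *)
Fixpoint expect {R : realType} (a : R) (k : nat) (F : seq bool -> R) : R :=
  if k is k'.+1 then expect1 a (fun b => expect a k' (fun s => F (b :: s)))
  else F [::].

Lemma eq_expect1 {R : realType} (a : R) (F G : bool -> R) :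
  F =1 G -> expect1 a F = expect1 a G.
Proof. by move=> FG; rewrite /expect1 !FG. Qed.

Lemma eq_expect {R : realType} (a : R) k (F G : seq bool -> R) :
  (forall s, size s = k -> F s = G s) -> expect a k F = expect a k G.
Proof.
elim: k F G => [|k IH] F G FG /=; first exact: FG.
by apply: eq_expect1 => b; apply: IH => s sk; apply: FG; rewrite /= sk.
Qed.

Lemma le_expect {R : realType} (a : R) k (F G : seq bool -> R) :
  0 <= a <= 1 -> (forall s, size s = k -> F s <= G s) ->
  expect a k F <= expect a k G.
Proof.
move=> /andP[a0 a1]; elim: k F G => [|k IH] F G FG /=; first exact: FG.
by rewrite /expect1 lerD // ler_wpM2l ?subr_ge0 //;
  apply: IH => s sk; apply: FG; rewrite /= sk.
Qed.

Lemma expect_cst {R : realType} (a c : R) k : expect a k (fun=> c) = c.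
Proof. by elim: k => [//|k IH] /=; rewrite /expect1 IH; ring. Qed.

Lemma expectD {R : realType} (a : R) k (F G : seq bool -> R) :
  expect a k (fun s => F s + G s) = expect a k F + expect a k G.
Proof. by elim: k F G => [//|k IH] F G /=; rewrite /expect1 !IH; ring. Qed.

Lemma expectZ {R : realType} (a c : R) k (F : seq bool -> R) :
  expect a k (fun s => c * F s) = c * expect a k F.
Proof. by elim: k F => [//|k IH] F /=; rewrite /expect1 !IH; ring. Qed.

Lemma expect_expect1 {R : realType} (a b : R) k (F : seq bool -> bool -> R) :
  expect a k (fun s => expect1 b (F s)) = expect1 b (fun y => expect a k (F^~ y)).
Proof. by rewrite /expect1 expectD !expectZ. Qed.

Lemma expect_exchange {R : realType} (a b : R) k l
    (F : seq bool -> seq bool -> R) :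
  expect a k (fun s => expect b l (F s)) =
  expect b l (fun u => expect a k (F^~ u)).
Proof.
elim: k F => [//|k IH] F /=.
rewrite expect_expect1; apply: eq_expect1 => y; exact: IH.
Qed.

Lemma expect_cat {R : realType} (a : R) k l (F : seq bool -> R) :
  expect a (k + l) F = expect a k (fun s => expect a l (fun u => F (s ++ u))).
Proof. by elim: k F => [//|k IH] F /=; apply: eq_expect1 => y; apply: IH. Qed.

Lemma expect_prod {R : realType} (a : R) k (w : bool -> R) :
  expect a k (fun s => \prod_(b <- s) w b) = expect1 a w ^+ k.
Proof.
elim: k => [|k IH] /=; first by rewrite big_nil expr0.
rewrite exprS -IH [in RHS]/expect1 mulrDl -!mulrA -!expectZ /expect1 -!expectZ.
by congr (_ + _); apply: eq_expect => s _; rewrite big_cons.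
Qed.

(** * The product law preserved by the growth rule *)

(** The update of one cell of the grid, with [true] standing for +1. The corner
F(i,r) is given, [z] is F(i,r) - F(i+1,r) and [x] is F(i,r+1) - F(i,r); the
result consists of the two steps that meet at F(i+1,r+1), in the order vertical,
horizontal. If the edge is open then F(i+1,r+1) = F(i,r), so that the outgoing
vertical step is the incoming horizontal one and vice versa. If it is closed,
the new corner is one more than the smaller of its two known neighbours. *)
Definition cell (z x o : bool) : bool * bool :=
  if [&& ~~ o, ~~ z & x] then (true, false) else (z, x).

(** One column, from bottom to top: the horizontal step is handed from each
cell to the next, and the result pairs the vertical steps of the next column
with the horizontal step that leaves at the top. *)
Fixpoint sweep (z : bool) (xs os : seq bool) : seq bool * bool :=
  if (xs, os) is (x :: xs', o :: os') then
    let: (x', z') := cell z x o in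
    let: (s, z'') := sweep z' xs' os' in (x' :: s, z'')
  else ([::], z).

(** The horizontal steps at height [h], one for each column; [os] lists the
edge states column by column. *)
Fixpoint outflow (h : nat) (zs xs os : seq bool) : seq bool :=
  if zs is z :: zs' then
    let: (xs', z') := sweep z xs (take h os) in
    z' :: outflow h zs' xs' (drop h os)
  else [::].

(** Only the outcomes (+,-) and (-,+) have different probabilities on the two
sides, by opposite amounts a' (1 - a) - p a (1 - a'). *)
Lemma expect_cell {R : realType} (p a a' : R) (G : bool -> bool -> R) :
  a' * (1 - a) = p * a * (1 - a') ->
  expect1 a' (fun z => expect1 a (fun x => expect1 p (fun o =>
    G (cell z x o).1 (cell z x o).2))) =
  expect1 a' (fun z => expect1 a (fun x => G x z)).
Proof.
move=> bal; rewrite /expect1 /cell /=.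
apply/eqP; rewrite -subr_eq0; apply/eqP.
transitivity ((a' * (1 - a) - p * a * (1 - a')) *
              (G true false - G false true)); first by ring.
by rewrite bal subrr mul0r.
Qed.

(** Since the horizontal step leaving a cell is independent of the vertical step
written there, it serves as a fresh input of the next cell. *)
Lemma expect_sweep {R : realType} (p a a' : R) h (G : seq bool -> bool -> R) :
  a' * (1 - a) = p * a * (1 - a') ->
  expect1 a' (fun z => expect a h (fun xs => expect p h (fun os =>
    G (sweep z xs os).1 (sweep z xs os).2))) =
  expect1 a' (fun z => expect a h (fun xs => G xs z)).
Proof.
move=> bal; elim: h G => [//|h IH] G.
pose H x' z' := expect a h (fun xs => expect p h (fun os =>
  G (x' :: (sweep z' xs os).1) (sweep z' xs os).2)).
transitivity (expect1 a' (fun z => expect1 a (fun x => expect1 p (fun o =>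
    H (cell z x o).1 (cell z x o).2)))).
  apply: eq_expect1 => z /=; apply: eq_expect1 => x.
  rewrite expect_expect1; apply: eq_expect1 => o; apply: eq_expect => xs _.
  apply: eq_expect => os _.
  by case: (cell z x o) => x' z' /=; case: (sweep _ _ _).
rewrite expect_cell //.
transitivity (expect1 a (fun x => expect1 a' (fun z => H x z))).
  by rewrite /expect1; ring.
under eq_expect1 => x do rewrite (IH (fun s => G (x :: s))).
by rewrite /= /expect1; ring.
Qed.

(** Each column leaves the vertical steps of the next one with the same law,
independent of the horizontal step that has left at the top, so the steps
collected there are independent. *)
Lemma expect_outflow {R : realType} (p a a' : R) h n (G : seq bool -> R) :
  a' * (1 - a) = p * a * (1 - a') ->
  expect p (n * h) (fun os => expect a' n (fun zs => expect a h (fun xs =>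
    G (outflow h zs xs os)))) = expect a' n G.
Proof.
move=> bal; elim: n G => [|n IH] G; first by rewrite mul0n /= expect_cst.
rewrite mulSn expect_cat /=.
pose H xs' z' := expect p (n * h) (fun os => expect a' n (fun zs =>
  G (z' :: outflow h zs xs' os))).
transitivity (expect1 a' (fun z => expect a h (fun xs => expect p h (fun os =>
    H (sweep z xs os).1 (sweep z xs os).2)))).
  under eq_expect => s _ do rewrite expect_expect1.
  rewrite expect_expect1; apply: eq_expect1 => z.
  rewrite [RHS]expect_exchange; apply: eq_expect => os szos.
  under eq_expect => s _ do rewrite expect_exchange.
  rewrite expect_exchange; apply: eq_expect => xs _.
  apply: eq_expect => s _; apply: eq_expect => zs _.
  by rewrite take_size_cat ?drop_size_cat //; case: (sweep _ _ _).
rewrite expect_sweep //; apply: eq_expect1 => z.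
rewrite -(IH (fun s => G (z :: s))) /H expect_exchange.
by apply: eq_expect => os _; rewrite expect_exchange.
Qed.

(** * Heights as lower bounds for the length of open paths *)

Definition spin (b : bool) : int := if b then 1 else -1.

Fixpoint column_flux (x o : nat -> bool) (z : bool) (r : nat) : bool :=
  if r is r'.+1 then (cell (column_flux x o z r') (x r') (o r')).2 else z.

Fixpoint slope (o : nat -> nat -> bool) (z x : nat -> bool) (i : nat) :
    nat -> bool :=
  if i is i'.+1 then
    let s := slope o z x i' in
    fun r => (cell (column_flux s (o i') (z i') r) (s r) (o i' r)).1
  else x.

Definition flux (o : nat -> nat -> bool) (z x : nat -> bool) (i r : nat) : bool :=
  column_flux (slope o z x i) (o i) (z i) r.

Definition height (o : nat -> nat -> bool) (z x : nat -> bool) (i r : nat) : int :=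
  \sum_(0 <= k < r) spin (slope o z x i k) - \sum_(0 <= k < i) spin (z k).

(** Going around a cell either way gives the same height increment; this is what
makes the heights well defined. *)
Lemma cell_spin z x o :
  spin (cell z x o).1 + spin (cell z x o).2 = spin z + spin x.
Proof. by case: o z x => [] [] []. Qed.

Lemma heightSr o z x i r :
  height o z x i r.+1 = height o z x i r + spin (slope o z x i r).
Proof. by rewrite /height big_nat_recr //=; ring. Qed.

Lemma heightSl o z x i r :
  height o z x i.+1 r = height o z x i r - spin (flux o z x i r).
Proof.
elim: r => [|r IH].
  by rewrite /height !(big_geq (leqnn 0)) big_nat_recr //= /flux /=; ring.
rewrite !heightSr IH /=.
have := cell_spin (flux o z x i r) (slope o z x i r) (o i r).
rewrite {4}/flux /= -/(flux o z x i r).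
set a := spin (cell _ _ _).1; set b := spin (cell _ _ _).2; lia.
Qed.

Lemma height_open (o : nat -> nat -> bool) z x i r :
  o i r -> height o z x i.+1 r.+1 = height o z x i r.
Proof.
by move=> oir; rewrite heightSr heightSl /= -/(flux o z x i r) oir /cell /=; ring.
Qed.

Lemma height_diff o z x n r0 R : (r0 <= R)%N ->
  height o z x n R - height o z x 0 r0 =
  \sum_(r0 <= k < R) spin (x k) - \sum_(0 <= i < n) spin (flux o z x i R).
Proof.
move=> leR; have -> : height o z x n R =
    height o z x 0 R - \sum_(0 <= i < n) spin (flux o z x i R).
  elim: n => [|n IH]; first by rewrite (big_geq (leqnn 0)) subr0.
  by rewrite heightSl IH big_nat_recr //=; ring.
by rewrite /height !(big_geq (leqnn 0)) (big_cat_nat (n := r0)) //=; ring.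
Qed.

(** Row [r] of column [i] sits at ordinate r - K - i, so the diagonal of a cell
is a horizontal edge, and increasing [i] at fixed [r] descends by one unit. *)
Definition sheared_edge (K i : nat) (r : nat) : edge :=
  ((i%:Z, r%:Z - K%:Z - i%:Z), false).

Definition sheared_config (w : config) (K : nat) (i r : nat) : bool :=
  w (sheared_edge K i r).

(** Heights are extended to all abscissae by freezing them outside [0, n]; a
horizontal edge there leaves the height unchanged, so paths may leave the
strip. *)
Definition clamp (n : nat) (a : int) : nat := minn n `|(Num.max a 0)%R|%N.

Definition potential (F : nat -> nat -> int) (n K : nat) (v : vertex) : int :=
  v.1 + F (clamp n v.1) `|(v.2 + K%:Z + (clamp n v.1)%:Z)%R|%N.

(** A vertical edge changes the height by one and the abscissa not at all; an
open horizontal edge does the opposite. *)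
Lemma potential_edge (w : config) z x n K e : w e ->
  - K%:Z <= (edge_src e).2 ->
  `|potential (height (sheared_config w K) z x) n K (edge_tgt e) -
    potential (height (sheared_config w K) z x) n K (edge_src e)| <= 1.
Proof.
case: e => [[a y] []] /= we ley.
  rewrite /potential /=; set i := clamp n a.
  have -> : `|(y + 1 + K%:Z + i%:Z)%R|%N = `|(y + K%:Z + i%:Z)%R|%N.+1 by lia.
  by rewrite heightSr; case: slope => /=; lia.
rewrite /potential /=.
have [/andP[a0 an]|aout] := boolP ((0 <= a) && (a < n%:Z)); last first.
  have -> : clamp n (a + 1) = clamp n a by rewrite /clamp; lia.
  lia.
have -> : clamp n (a + 1) = `|a|%N.+1 by rewrite /clamp; lia.
have -> : clamp n a = `|a|%N by rewrite /clamp; lia.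
have -> : `|(y + K%:Z + `|a|%N.+1%:Z)%R|%N = `|(y + K%:Z + `|a|%N%:Z)%R|%N.+1 by lia.
rewrite height_open; first lia.
rewrite /sheared_config /sheared_edge.
have -> : `|a|%N%:Z = a by lia.
have -> : `|(y + K%:Z + a)%R|%N%:Z - K%:Z - a = y by lia.
by [].
Qed.

(** The size hypothesis keeps the path above ordinate -K, where the window
begins. *)
Lemma potential_path (w : config) z x n K v u s : open_path w v u s ->
  (size s)%:Z - K%:Z <= v.2 ->
  potential (height (sheared_config w K) z x) n K u <=
  potential (height (sheared_config w K) z x) n K v + (size s)%:Z.
Proof.
set h := potential _ n K.
elim: s v => [|v' s IH] v [/= pvs] vu hs; first by rewrite vu; lia.
move/andP: pvs => [/asboolP[e [we ends]] pvs].
have hv : v.2 - 1 <= v'.2 /\ - K%:Z <= (edge_src e).2.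
  case: e ends {we} hs => [[a y] b] /= [] [];
    by rewrite /edge_src /edge_tgt => <- <-; case: b => /=; lia.
have := @potential_edge w z x n K e we hv.2; rewrite -/h => step.
have := IH v' (conj pvs vu) ltac:(lia).
by case: ends => [] [es et]; rewrite es et in step; lia.
Qed.

(** The increment of the height between the endpoints, read up the first column
and then along row [R]; [K] is the row of the origin. *)
Lemma size_open_path_ge (w : config) z x n K (Y : int) s :
  open_path w origin (n%:Z, Y) s -> (size s <= K)%N -> 0 <= Y + n%:Z ->
  let R := (K + `|(Y + n%:Z)%R|)%N in
  n%:Z + \sum_(K <= k < R) spin (x k)
  - \sum_(0 <= i < n) spin (flux (sheared_config w K) z x i R) <= (size s)%:Z.
Proof.
move=> ps sK Yn; set R := (K + _)%N; rewrite /=.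
have := @potential_path w z x n K _ _ _ ps; rewrite /origin /= => /(_ ltac:(lia)).
rewrite /potential /=.
have -> : clamp n n%:Z = n by rewrite /clamp; lia.
have -> : clamp n 0 = 0%N by rewrite /clamp; lia.
have -> : `|(Y + K%:Z + n%:Z)%R|%N = R by lia.
rewrite [X in height _ _ _ 0 X](_ : _ = K); last lia.
by move=> le_h; rewrite -addrA -height_diff ?leq_addr //; lia.
Qed.

(** * Averaging the bound over the boundary *)

Lemma column_fluxS x o z r :
  column_flux x o z r.+1 =
  column_flux (x \o succn) (o \o succn) (cell z (x 0%N) (o 0%N)).2 r.
Proof. by elim: r => [//|r IH]; rewrite [LHS]/= -/(column_flux x o z r.+1) IH. Qed.

Lemma mkseqS {T : Type} (f : nat -> T) n : mkseq f n.+1 = f 0%N :: mkseq (f \o succn) n.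
Proof. by rewrite /mkseq /= -[1%N]addn0 iotaDl -map_comp. Qed.

Lemma sweep_mkseq z x o h :
  sweep z (mkseq x h) (mkseq o h) =
  (mkseq (fun r => (cell (column_flux x o z r) (x r) (o r)).1) h,
   column_flux x o z h).
Proof.
elim: h z x o => [//|h IH] z x o; rewrite !mkseqS /=.
case E : (cell z (x 0%N) (o 0%N)) => [x' z'] /=; rewrite IH.
rewrite -/(column_flux x o z h.+1) column_fluxS E /=; congr (_ :: _, _).
apply: eq_mkseq => r /=.
by rewrite -/(column_flux x o z r.+1) column_fluxS E.
Qed.

Lemma size_outflow h zs xs os : size (outflow h zs xs os) = size zs.
Proof.
elim: zs xs os => [//|z zs IH] xs os /=.
by case: (sweep _ _ _) => s b /=; rewrite IH.
Qed.

Lemma slopeS o z x i :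
  slope o z x i.+1 = slope (o \o succn) (z \o succn) (slope o z x 1) i.
Proof.
elim: i => [//|i IH]; pose step s := fun r =>
  (cell (column_flux s (o i.+1) (z i.+1) r) (s r) (o i.+1 r)).1.
by rewrite -[LHS]/(step (slope o z x i.+1)) IH.
Qed.

Lemma outflow_mkseq (o : nat -> nat -> bool) z x n h :
  outflow h (mkseq z n) (mkseq x h) (flatten (mkseq (fun i => mkseq (o i) h) n)) =
  mkseq (fun i => flux o z x i h) n.
Proof.
elim: n o z x => [//|n IH] o z x; rewrite !mkseqS /=.
rewrite take_size_cat ?drop_size_cat ?size_mkseq // sweep_mkseq IH.
by congr (_ :: _); apply: eq_mkseq => i; rewrite /= /flux slopeS.
Qed.

Definition window (K n h : nat) : seq edge :=
  flatten (mkseq (fun i => mkseq (sheared_edge K i) h) n).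

Lemma size_window K n h : size (window K n h) = (n * h)%N.
Proof.
rewrite /window; elim: n => [//|n IH].
by rewrite /mkseq -[n.+1]addn1 iotaD map_cat flatten_cat size_cat IH /= cats0
  size_map size_iota mulnDl mul1n.
Qed.

Lemma uniq_window K n h : uniq (window K n h).
Proof.
rewrite /window /mkseq; apply: allpairs_uniq_dep; rewrite ?iota_uniq //.
move=> u v _ _; case: u => i r; case: v => j q /=; rewrite /sheared_edge => -[ij rq].
by rewrite ij (_ : r = q) //; lia.
Qed.

(** The previous bound for boundary steps given as lists, which is the form that
can be averaged. *)
Lemma size_open_path_boundary (w : config) n K (Y : int) s zs xs :
  let R := (K + `|(Y + n%:Z)%R|)%N in
  open_path w origin (n%:Z, Y) s -> (size s <= K)%N -> 0 <= Y + n%:Z ->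
  size zs = n -> size xs = R ->
  n%:Z + \sum_(b <- drop K xs) spin b
  - \sum_(b <- outflow R zs xs (map w (window K n R))) spin b <= (size s)%:Z.
Proof.
move=> R ps sK Yn szs sxs.
have := @size_open_path_ge w (nth false zs) (nth false xs) n K Y s ps sK Yn.
rewrite /= -/R.
have -> : outflow R zs xs (map w (window K n R)) =
    mkseq (fun i => flux (sheared_config w K) (nth false zs) (nth false xs) i R) n.
  rewrite -outflow_mkseq -{2}szs -[in mkseq _ R]sxs !mkseq_nth.
  rewrite /window map_flatten /mkseq -map_comp.
  by congr outflow; congr flatten; apply: eq_map => i /=; rewrite -map_comp.
rewrite big_map /index_iota subn0.
have -> : \sum_(b <- drop K xs) spin b = \sum_(K <= k < R) spin (nth false xs k).
  have -> : drop K xs = map (nth false xs) (iota K (R - K)).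
    rewrite map_nth_iota ?sxs // ?leq_addr //.
    by rewrite take_oversize // size_drop sxs.
  by rewrite big_map.
by [].
Qed.

(** With exponential weights, the average over the boundary of a Chernoff bound
for the event that the vertical sum is small or the horizontal sum is large; it
depends on the edge states only. Treating the two sums separately avoids their
dependence. *)
Definition short_path_weight {R : realType} (a a' : R) (w1 w2 : bool -> R)
    (K n h : nat) (os : seq bool) : R :=
  expect a' n (fun zs => expect a h (fun xs =>
    \prod_(b <- drop K xs) w1 b + \prod_(b <- outflow h zs xs os) w2 b)).

(** The first product involves no edge, and for the second the steps at the top
of the grid are independent by [expect_outflow]. *)
Lemma expect_short_path_weight {R : realType} (p a a' : R) (w1 w2 : bool -> R)
    (K n m : nat) : a' * (1 - a) = p * a * (1 - a') ->
  expect p (n * (K + m)) (short_path_weight a a' w1 w2 K n (K + m)) =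
  expect1 a w1 ^+ m + expect1 a' w2 ^+ n.
Proof.
move=> bal; rewrite /short_path_weight.
under eq_expect => os _.
  under eq_expect => zs _ do rewrite expectD.
  rewrite expectD; over.
rewrite expectD; congr (_ + _).
  rewrite !expect_cst expect_cat -expect_prod -[RHS](expect_cst a _ K).
  apply: eq_expect => s sK; apply: eq_expect => u _.
  by rewrite drop_size_cat.
by rewrite (expect_outflow p a a' (K + m) n (fun s => \prod_(b <- s) w2 b)) //
  expect_prod.
Qed.

(** For every boundary, a short path forces one of the two exponents to be
nonnegative. *)
Lemma short_path_weight_ge1 {R : realType} (a a' c1 c2 t1 t2 : R) (w : config)
    n K (Y : int) s :
  0 <= a <= 1 -> 0 <= a' <= 1 -> 0 <= t1 -> 0 <= t2 ->
  open_path w origin (n%:Z, Y) s -> (size s <= K)%N -> 0 <= Y + n%:Z ->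
  (size s)%:R <= n%:R + c1 * (Y%:~R + n%:R) - c2 * n%:R ->
  let h := (K + `|(Y + n%:Z)%R|)%N in
  1 <= short_path_weight a a' (fun b => expR (t1 * (c1 - (spin b)%:~R)))
         (fun b => expR (t2 * ((spin b)%:~R - c2))) K n h
         (map w (window K n h)).
Proof.
move=> a01 a'01 t10 t20 ps sK Yn short; set h := (K + _)%N; rewrite /=.
rewrite /short_path_weight -[leLHS](expect_cst a' 1 n); apply: le_expect => // zs szs.
rewrite -[leLHS](expect_cst a 1 h); apply: le_expect => // xs sxs.
have /= := @size_open_path_boundary w n K Y s zs xs ps sK Yn szs sxs.
rewrite -/h; set os := outflow _ _ _ _ => len.
have szos : size os = n by rewrite size_outflow.
rewrite /= -!expR_sum -!mulr_sumr.
have lenR : n%:R + (\sum_(b <- drop K xs) spin b)%:~R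
            - (\sum_(b <- os) spin b)%:~R <= (size s)%:R :> R.
  by rewrite -[n%:R]/(n%:Z%:~R) -[(size s)%:R]/((size s)%:Z%:~R)
    -rmorphD -rmorphB ler_int.
have slack : 0 <= \sum_(b <- drop K xs) (c1 - (spin b)%:~R) +
                  \sum_(b <- os) ((spin b)%:~R - c2).
  rewrite !sumrB !big_const_seq !count_predT !iter_addr !addr0 szos size_drop sxs.
  rewrite -!rmorph_sum /=.
  have -> : (h - K)%N = `|(Y + n%:Z)%R|%N by rewrite /h addKn.
  rewrite -[c1 *+ _]mulr_natr -[c2 *+ n]mulr_natr.
  have -> : `|(Y + n%:Z)%R|%N%:R = Y%:~R + n%:R :> R.
    by rewrite natr_absz ger0_norm // rmorphD.
  lra.
have ge1 (t S : R) : 0 <= t -> 0 <= S -> 1 <= expR (t * S).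
  by move=> t0 S0; rewrite (le_trans _ (expR_ge1Dx _)) // lerDl mulr_ge0.
have [S1|S1] := leP 0 (\sum_(b <- drop K xs) (c1 - (spin b)%:~R)).
  by rewrite (le_trans (ge1 t1 _ t10 S1)) // lerDl expR_ge0.
have S2 : 0 <= \sum_(b <- os) ((spin b)%:~R - c2) by lra.
by rewrite (le_trans (ge1 t2 _ t20 S2)) // lerDr expR_ge0.
Qed.

(** * From finite averages to the percolation measure *)

(** The product rule concerns open edges only. The edges in [J] are kept open to
allow induction on [es]: a closed edge is treated by removing from the event
without condition on it the part where it is open. *)
Lemma bernoulli_cylinder {R : realType} {d : measure_display}
    {T : measurableType d} {P : probability T R} {p : R} {X : T -> config}
    (es J : seq edge) (B : seq bool -> bool) :
  bernoulli_percolation P p X -> uniq (J ++ es) ->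
  let A := [set t | all (X t) J && B (map (X t) es)] in
  measurable A /\
  P A = (p ^+ size J * expect p (size es) (fun s => (B s)%:R))%:E.
Proof.
move=> [mX pX iX]; elim: es J B => [|e es IH] J B uJ A.
  rewrite cats0 in uJ.
  have mJ : measurable [set t | forall e, e \in J -> X t e].
    rewrite (_ : [set t | _] = \bigcap_(e in [set` J]) [set t | X t e]) //.
    by apply: fin_bigcap_measurable => [|e _]; [exact: finite_seq|exact: mX].
  rewrite /A /=; case: (B [::]); last first.
    rewrite (_ : [set t | _] = set0).
      by rewrite measure0 mulr0; split.
    by apply/seteqP; split => t //=; rewrite andbF.
  rewrite (_ : [set t | _] = [set t | forall e, e \in J -> X t e]).
    split => //; rewrite iX // mulr1.
    by elim: J {uJ mJ A} => [|e J IHJ]; rewrite ?big_nil ?expr0 // big_cons IHJ pX exprS.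
  by apply/seteqP; split => t /=; rewrite andbT => /allP.
have uJe : uniq (rcons J e ++ es) by rewrite cat_rcons.
have uJ' : uniq (J ++ es).
  by move: uJ; rewrite !cat_uniq /= negb_or -!andbA => /and5P[-> _ -> _ ->].
have [m1 P1] := IH (rcons J e) (fun s => B (true :: s)) uJe.
have [m01 P01] := IH (rcons J e) (fun s => B (false :: s)) uJe.
have [m0 P0] := IH J (fun s => B (false :: s)) uJ'.
set A1 := [set t | _] in m1 P1; set A01 := [set t | _] in m01 P01.
set A0 := [set t | _] in m0 P0.
have AE : A = A1 `|` (A0 `\` A01).
  apply/seteqP; split => t; rewrite /A /A1 /A0 /A01 /= !all_rcons.
    by case: (X t e) => /= H; [left|right; split].
  case: (X t e) => /= -[]//; first by case.
  by case.
have I01 : A0 `&` A01 = A01.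
  by apply/setIidr => t; rewrite /A0 /A01 /= all_rcons => /andP[/andP[_ ->] ->].
split; first by rewrite AE; apply: measurableU => //; exact: measurableD.
rewrite AE measureU //; last 2 first.
- exact: measurableD.
- apply/seteqP; split => t //=; rewrite /A0 /A01 /A1 /= !all_rcons.
  by move=> -[/andP[/andP[-> J1] _] [/andP[_ ->]]]; rewrite J1.
rewrite measureD //; last by rewrite [X in (X < _)%E]P0 ltry.
rewrite I01; apply: (etrans (congr2 adde P1 (congr2 (fun u v => u - v)%E P0 P01))).
rewrite size_rcons exprS /=; congr EFin; rewrite /expect1; ring.
Qed.

Lemma bernoulli_markov {R : realType} {d : measure_display}
    {T : measurableType d} {P : probability T R} {p : R} {X : T -> config}
    (es : seq edge) (f : seq bool -> R) :
  bernoulli_percolation P p X -> 0 <= p <= 1 -> uniq es ->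
  (forall s, 0 <= f s) ->
  let A := [set t | 1 <= f (map (X t) es)] in
  measurable A /\ (P A <= (expect p (size es) f)%:E)%E.
Proof.
move=> hX p01 ues f0 A.
have [mA PA] := bernoulli_cylinder es [::] (fun s => 1 <= f s) hX ues.
split => //; rewrite [P A]PA expr0 mul1r lee_fin; apply: le_expect => // s _.
by case: (leP 1 (f s)).
Qed.

Lemma borel_cantelli_geometric {R : realType} {d : measure_display}
    {T : measurableType d} (P : probability T R) (B : nat -> set T) (C r : R) :
  0 <= C -> 0 < r < 1 -> (forall n, measurable (B n)) ->
  (forall n, (P (B n) <= (C * r ^+ n)%:E)%E) ->
  P.-negligible (lim_sup_set B).
Proof.
move=> C0 /andP[r0 r1] mB PB.
have mL : measurable (lim_sup_set B).
  by apply: bigcap_measurableType => n _; apply: bigcup_measurable.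
apply/negligibleP => //; apply: lim_sup_set_cvg0 => //.
apply: (@le_lt_trans _ _ (C * (1 - r)^-1)%:E); last exact: ltry.
apply: lime_le; first by apply: is_cvg_nneseries => n _ _; exact: measure_ge0.
apply: nearW => n.
apply: (@le_trans _ _ (\sum_(0 <= k < n) (C * r ^+ k)%:E)%E).
  by apply: lee_sum => k _; exact: PB.
rewrite sumEFin lee_fin.
by apply: (@geometric_le_lim R n C r) => //; rewrite ger0_norm // ltW.
Qed.

(** The exponential moment has value 1 and negative derivative at t = 0. *)
Lemma expect1_expR_lt1 {R : realType} (a : R) (y : bool -> R) :
  0 <= a <= 1 -> expect1 a y < 0 ->
  exists2 t, 0 <= t & expect1 a (fun b => expR (t * y b)) < 1.
Proof.
move=> a01 my.
pose c : R := 1 + `|y true| + `|y false|.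
have c1 : 1 <= c by rewrite /c -addrA lerDl addr_ge0.
have yc b : `|y b| <= c.
  by rewrite /c; case: b; have := normr_ge0 (y true); have := normr_ge0 (y false); lra.
(* From exp (- x) >= 1 - x, as 1 / (1 - x) <= 1 + x + 2 x^2 for x <= 1 / 2. *)
have quad (x : R) : x <= 1 / 2 -> expR x <= 1 + x + 2 * x ^+ 2.
  move=> x2; have pos : 0 < 1 - x by lra.
  have : expR x <= (1 - x)^-1.
    rewrite -[expR x]invrK -expRN lef_pV2 ?posrE ?expR_gt0 //.
    exact: expR_ge1Dx.
  move=> /le_trans; apply; rewrite -div1r ler_pdivrMr //.
  by have := sqr_ge0 x; nra.
pose e : R := - expect1 a y; have e0 : 0 < e by rewrite oppr_gt0.
have ec : e <= c.
  rewrite /e /expect1; move: (yc true) (yc false); rewrite !ler_norml.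
  by move: a01 => /andP[? ?] /andP[? ?] /andP[? ?]; nra.
(* This t minimizes 1 - t e + 2 t^2 c^2, the bound obtained below. *)
pose t : R := e / (4 * c ^+ 2).
have c20 : 0 < 4 * c ^+ 2 by rewrite mulr_gt0 // exprn_gt0 //; lra.
have t0 : 0 < t by rewrite divr_gt0.
have tc2 : t * (4 * c ^+ 2) = e by rewrite /t divfK // gt_eqF.
have tc : t * c <= 1 / 4 by nra.
exists t; first exact: ltW.
have ub b : expR (t * y b) <= 1 + t * y b + 2 * t ^+ 2 * c ^+ 2.
  have yb := yc b; rewrite ler_norml in yb; case/andP: yb => y1 y2.
  have := quad (t * y b) ltac:(nra); move/le_trans; apply.
  have : y b ^+ 2 <= c ^+ 2 by nra.
  by rewrite exprMn; have := sqr_ge0 t; nra.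
have := ub true; have := ub false; set E1 := expR _; set E2 := expR _ => u1 u2.
apply: (@le_lt_trans _ _ (1 - t * e + 2 * t ^+ 2 * c ^+ 2)).
  rewrite /expect1 /e /expect1 -/E1 -/E2; move: a01 => /andP[? ?].
  have h1 : a * E2 <= a * (1 + t * y true + 2 * t ^+ 2 * c ^+ 2) by exact: ler_wpM2l.
  have h2 : (1 - a) * E1 <= (1 - a) * (1 + t * y false + 2 * t ^+ 2 * c ^+ 2).
    by apply: ler_wpM2l => //; rewrite subr_ge0.
  nra.
have -> : 2 * t ^+ 2 * c ^+ 2 = t * e / 2 by rewrite -tc2; field.
have := mulr_gt0 t0 e0; lra.
Qed.

(** * The time constant *)

Lemma chemical_distanceP (c : config) v w : connected_to c v w ->
  exists2 s, open_path c v w s & size s = chemical_distance c v w.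
Proof.
move=> [s0 ps0].
have ex : exists k, `[< exists2 s, open_path c v w s & size s = k >].
  by exists (size s0); apply/asboolP; exists s0.
have [k /asboolP[s ps sk] mink] := ex_minnP ex.
have minP : is_min_path_length c v w k.
  split; first by exists s.
  by move=> u pu; apply: mink; apply/asboolP; exists u.
by have [+ _] : is_min_path_length c v w (chemical_distance c v w)
  by exact: (xgetPex 0%N (ex_intro _ k minP)).
Qed.

(** The abscissa of the point to be rounded is an integer, so rounding does not
move it. *)
Lemma target_coordinates {R : realType} (rd : R * R -> vertex) (p lambda : R) n :
  is_lattice_rounding rd ->
  let v := target rd p lambda n in
  v.1 = n%:Z /\ `|v.2%:~R - n%:R * (lambda * (1 - p))| <= 1.
Proof.
move=> hrd v; set y := n%:R * _.
have near w : (n%:R - v.1%:~R) ^+ 2 + (y - v.2%:~R) ^+ 2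
           <= (n%:R - w.1%:~R) ^+ 2 + (y - w.2%:~R) ^+ 2 :> R.
  have := hrd (n%:R, y) w; rewrite /euclidean_dist /lattice_point /=.
  by rewrite ler_sqrt // addr_ge0 ?sqr_ge0.
split.
  have := near (n%:Z, v.2); rewrite /= subrr expr0n /= add0r gerDr => h.
  have /eqP : (n%:R - v.1%:~R) ^+ 2 == 0 :> R by rewrite eq_le h sqr_ge0.
  by move/eqP; rewrite sqrf_eq0 subr_eq0 -[n%:R]/(n%:Z%:~R) eqr_int => /eqP.
have := near (v.1, Num.floor y); rewrite lerD2l => h.
have fl : 0 <= y - (Num.floor y)%:~R <= 1.
  by have := floor_itv y; rewrite intrD => /andP[? ?]; lra.
have h1 : (y - v.2%:~R) ^+ 2 <= 1.
  by apply: (le_trans h) => /=; case/andP: fl => f0 f1; rewrite expr_le1.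
by rewrite distrC -(@expr_le1 _ 2) // real_normK ?num_real.
Qed.

(** The densities are a = (1 + s) / 2 with s = lambda q and
q = sqrt (p / (1 - e lambda^2)), and a' is then forced by the balance. This s is
the slope that maximizes s th + 1 - sqrt (1 - e + e s^2) with th = lambda e;
the speed 2 (a - a') of the heights is at least 1 - sqrt (1 - e + e s^2), which
equals 1 - q. *)
Lemma optimal_densities {R : realType} (p lambda : R) :
  1 / 2 < p < 1 -> 0 <= lambda <= 1 ->
  exists a a' : R, [/\ 0 <= a <= 1, 0 <= a' <= 1,
    a' * (1 - a) = p * a * (1 - a') &
    2 - Num.sqrt (1 - (1 - p) * (1 + lambda ^+ 2)
                  + lambda ^+ 2 * (1 - p) ^+ 2) <=
    1 + (2 * a - 1) * (1 + lambda * (1 - p)) - (2 * a' - 1)].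
Proof.
move=> /andP[p2 p1] /andP[l0 l1].
pose e : R := 1 - p; have pE : p = 1 - e by rewrite /e; ring.
have e0 : 0 < e by rewrite /e; lra.
have e2 : e < 1 / 2 by rewrite /e; lra.
have l21 : lambda ^+ 2 <= 1 by rewrite expr_le1.
have l20 : 0 <= lambda ^+ 2 by rewrite sqr_ge0.
pose u : R := 1 - e * lambda ^+ 2; have u0 : 0 < u by rewrite /u; nra.
pose q : R := Num.sqrt (p / u).
have q0 : 0 <= q by rewrite sqrtr_ge0.
have qq : q ^+ 2 * u = p.
  rewrite sqr_sqrtr ?divfK ?gt_eqF // divr_ge0 ?(ltW u0) //; lra.
have q1 : q <= 1.
  rewrite -(@expr_le1 _ 2) //; have : p <= u by rewrite pE /u; nra.
  by rewrite -{1}qq ger_pMl.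
pose s : R := lambda * q.
have s0 : 0 <= s by rewrite mulr_ge0.
have s1 : s <= 1 by rewrite mulr_ile1.
pose a : R := (1 + s) / 2.
have a0 : 0 <= a by rewrite /a; lra.
have a1 : a <= 1 by rewrite /a; lra.
pose w : R := 1 - e * a; have w0 : 0 < w by rewrite /w; nra.
pose a' : R := p * a / w.
have a'w : a' * w = p * a by rewrite /a' divfK // gt_eqF.
have a'0 : 0 <= a' by rewrite divr_ge0 ?(ltW w0) // mulr_ge0 //; lra.
have a'1 : a' <= 1 by rewrite ler_pdivrMr // mul1r /w pE; nra.
have bal : a' * (1 - a) = p * a * (1 - a') by move: a'w; rewrite /w pE; lra.
exists a, a'; split; rewrite ?a0 ?a'0 //.
have -> : Num.sqrt (1 - (1 - p) * (1 + lambda ^+ 2)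
                  + lambda ^+ 2 * (1 - p) ^+ 2) = q * u.
  rewrite -[RHS]ger0_norm ?mulr_ge0 ?(ltW u0) // -sqrtr_sqr; congr Num.sqrt.
  have -> : (q * u) ^+ 2 = q ^+ 2 * u * u by ring.
  by rewrite qq pE /u; ring.
have gain : (a - a') * w = e * a * (1 - a).
  by rewrite mulrBl a'w pE /w; ring.
have sq : e * (1 - s ^+ 2) = 1 - q ^+ 2.
  have : q ^+ 2 * (1 - e * lambda ^+ 2) = 1 - e by rewrite -pE -qq.
  rewrite /s exprMn; lra.
have key : 1 - q <= 2 * (a - a').
  rewrite -(ler_pM2r w0) -mulrA gain.
  have -> : 2 * (e * a * (1 - a)) = (1 - q) * (1 + q) / 2.
    have -> : (1 - q) * (1 + q) = e * (1 - s ^+ 2) by rewrite sq; ring.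
    by rewrite /a; field.
  rewrite -mulrA ler_wpM2l ?subr_ge0 //.
  suff : 1 - e - e * s <= q by rewrite /w /a; lra.
  have [neg|pos] := leP (1 - e - e * s) 0; first exact: le_trans q0.
  rewrite -(@ler_pXn2r _ 2) ?nnegrE ?(ltW pos) //.
  have -> : q ^+ 2 = 1 - e + e * s ^+ 2 by lra.
  have : 0 <= e * (1 - e) * (1 + s) ^+ 2.
    by rewrite mulr_ge0 ?sqr_ge0 // mulr_ge0 ?(ltW e0) //; lra.
  nra.
have -> : 1 - p = e by [].
have -> : 2 * a - 1 = s by rewrite /a; field.
have -> : s * (1 + lambda * e) = s + q - q * u by rewrite /u /s; ring.
have : s = 2 * a - 1 by rewrite /a; field.
lra.
Qed.

(** The window starts 2 n rows below the origin, so it contains all paths of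
length at most 2 n. The exponential rates obtained do not depend on n, whence
a geometric bound and Borel-Cantelli. *)
Lemma rare_short_paths {R : realType} {d : measure_display}
    {T : measurableType d} (P : probability T R) (p lambda : R)
    (X : T -> config) (rd : R * R -> vertex) (a a' delta : R) :
  bernoulli_percolation P p X -> is_lattice_rounding rd ->
  0 <= p <= 1 -> 0 <= lambda -> 0 < delta ->
  0 <= a <= 1 -> 0 <= a' <= 1 -> a' * (1 - a) = p * a * (1 - a') ->
  exists2 B : nat -> set T, P.-negligible (lim_sup_set B) &
  forall t n s, let v := target rd p lambda n in
    (0 < n)%N -> open_path (X t) origin v s -> (size s <= n.*2)%N ->
    (size s)%:R <= n%:R + (2 * a - 1 - delta) * (v.2%:~R + n%:R)
                        - (2 * a' - 1 + delta) * n%:R ->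
    B n t.
Proof.
move=> hX hrd p01 l0 d0 a01 a'01 bal.
pose c1 : R := 2 * a - 1 - delta; pose c2 : R := 2 * a' - 1 + delta.
have [t1 t10 rho1] : exists2 t, 0 <= t &
    expect1 a (fun b => expR (t * (c1 - (spin b)%:~R))) < 1.
  by apply: expect1_expR_lt1 => //; rewrite /expect1 /spin /c1 intrN mulr1z; nra.
have [t2 t20 rho2] : exists2 t, 0 <= t &
    expect1 a' (fun b => expR (t * ((spin b)%:~R - c2))) < 1.
  by apply: expect1_expR_lt1 => //; rewrite /expect1 /spin /c2 intrN mulr1z; nra.
pose w1 b : R := expR (t1 * (c1 - (spin b)%:~R)).
pose w2 b : R := expR (t2 * ((spin b)%:~R - c2)).
pose r : R := Num.max (1 / 2) (Num.max (expect1 a w1) (expect1 a' w2)).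
have expect1_ge0 (x : R) (w : bool -> R) : 0 <= x <= 1 ->
    (forall b, 0 <= w b) -> 0 <= expect1 x w.
  by move=> /andP[x0 x1] w0; rewrite addr_ge0 // mulr_ge0 // subr_ge0.
have r0 : 0 < r by rewrite lt_max; apply/orP; left; lra.
have r1 : r < 1 by rewrite !gt_max rho1 rho2 !andbT; lra.
have r1' : expect1 a w1 <= r by rewrite !le_max lexx orbT.
have r2' : expect1 a' w2 <= r by rewrite !le_max lexx !orbT.
pose Y n := (target rd p lambda n).2.
pose m n := `|(Y n + n%:Z)%R|%N.
have Yn n : (0 < n)%N -> 0 <= Y n + n%:Z /\ (n.-1 <= m n)%N.
  move=> n0; have [_] := @target_coordinates R rd p lambda n hrd.
  rewrite -/(Y n) ler_norml => /andP[+ _].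
  have : 0 <= n%:R * (lambda * (1 - p)).
    by rewrite !mulr_ge0 // subr_ge0; case/andP: p01.
  move=> h1 h2; have : (-1)%:~R <= (Y n)%:~R :> R by rewrite intrN mulr1z; lra.
  by rewrite ler_int /m; move: (Y n) n0 => y; clear; lia.
pose f n := short_path_weight a a' w1 w2 n.*2 n (n.*2 + m n).
pose es n := window n.*2 n (n.*2 + m n).
have f0 n s : 0 <= f n s.
  rewrite -(expect_cst a' 0 n); apply: le_expect => // zs _.
  rewrite -[leLHS](expect_cst a 0 (n.*2 + m n)); apply: le_expect => // xs _.
  by rewrite addr_ge0 // prodr_ge0 // => b _; exact: expR_ge0.
have markov n := bernoulli_markov (es n) (f n) hX p01 (uniq_window _ _ _) (f0 n).
exists (fun n => [set t | 1 <= f n (map (X t) (es n))]).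
  apply: (@borel_cantelli_geometric R d T P _ (2 / r) r).
  - by rewrite divr_ge0 // ltW.
  - by rewrite r0 r1.
  - by move=> n; have [] := markov n.
  move=> n; have [_] := markov n; move/le_trans; apply.
  rewrite lee_fin size_window expect_short_path_weight //.
  have -> : 2 / r * r ^+ n = r ^+ n / r + r ^+ n / r by field; rewrite gt_eqF.
  have pw (x : R) k : 0 <= x <= r -> (n.-1 <= k)%N -> x ^+ k <= r ^+ n / r.
    move=> /andP[x0 xr] nk; apply: (@le_trans _ _ (r ^+ k)).
      by rewrite lerXn2r ?nnegrE // ltW.
    rewrite ler_pdivlMr // -exprSr.
    by rewrite ler_wiXn2l ?(ltW r0) ?(ltW r1) // (leq_trans (leqSpred n)).
  apply: lerD; apply: pw; rewrite ?leq_pred //.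
  - by rewrite expect1_ge0 // => b; exact: expR_ge0.
  - by case: (posnP n) => [->//|/Yn[]].
  - by rewrite expect1_ge0 // => b; exact: expR_ge0.
move=> t n s v n0 ps s2n short; have [Y0 _] := Yn n n0.
have [v1 _] := @target_coordinates R rd p lambda n hrd.
have vE : v = (n%:Z, Y n) by rewrite /v [LHS]surjective_pairing v1.
rewrite vE in ps; rewrite /= /f /es.
exact: (@short_path_weight_ge1 R a a' c1 c2 t1 t2 (X t) n n.*2 (Y n) s).
Qed.

Lemma infinite_nat_ge (N : set nat) m : infinite_set N -> exists2 n, (m <= n)%N & N n.
Proof.
move=> infN; apply: contrapT => noN; apply: infN.
apply: (sub_finite_set _ (finite_II m)) => n Nn /=.
by rewrite ltnNge; apply/negP => mn; apply: noN; exists n.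
Qed.

Theorem theorem2 (R : realType) (d : measure_display) (T : measurableType d)
    (P : probability T R) (p lambda : R) (X : T -> config)
    (rd : R * R -> vertex) (mu : R)
    (hp : 1 / 2 < p < 1) (hlambda : 0 <= lambda <= 1)
    (hX : bernoulli_percolation P p X)
    (hrd : is_lattice_rounding rd)
    (hmu : is_time_constant P X rd p lambda mu) :
  mu >= 2 - Num.sqrt (1 - (1 - p) * (1 + lambda ^+ 2)
                      + lambda ^+ 2 * (1 - p) ^+ 2).
Proof.
set b := 2 - _; rewrite leNgt; apply/negP => mub.
have b2 : b <= 2 by rewrite /b gerBl sqrtr_ge0.
have [a [a' [a01 a'01 bal gain]]] := optimal_densities p lambda hp hlambda.
rewrite -/b in gain.
have /andP[p2 p1] := hp; have /andP[l0 l1] := hlambda.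
pose eta := b - mu; have eta0 : 0 < eta by rewrite subr_gt0.
(* The margin delta costs at most 3 delta n, and rounding the target at most 2;
   together they stay below n eta / 2 once n eta >= 8. *)
pose delta := Num.min 1 (eta / 16).
have d0 : 0 < delta by rewrite lt_min ltr01 divr_gt0.
have d1 : delta <= 1 by rewrite ge_min lexx.
have d16 : delta <= eta / 16 by rewrite ge_min lexx orbT.
have p01 : 0 <= p <= 1 by lra.
have [B negB shortB] := @rare_short_paths R d T P p lambda X rd a a' delta
  hX hrd p01 l0 d0 a01 a'01 bal.
have limB t : distance_limit rd p lambda (X t) mu -> lim_sup_set B t.
  move=> [infN lim] k _.
  have : mu < b - eta / 2 by rewrite /eta; lra.
  move/(cvgr_lt _ lim); rewrite near_withinE => -[k0 _ ev].
  (* Beyond k1 the rounding error is absorbed by the margin. *)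
  pose k1 := Num.truncn (8 / eta).
  have [n + Nn] := @infinite_nat_ge _ (maxn k (maxn k0 k1.+1)) infN.
  rewrite !geq_max => /and3P[kn k0n k1n].
  have n0 : (0 < n)%N by exact: leq_ltn_trans k1n.
  have nR : 0 < n%:R :> R by rewrite ltr0n.
  exists n => //.
  have [s ps ss] := chemical_distanceP _ _ _ Nn.
  have := ev n k0n Nn.
  rewrite /= -ss ltr_pdivrMr // => short.
  have s2n : (size s <= n.*2)%N.
    rewrite -(ler_nat R) -muln2 natrM; apply/ltW/(lt_le_trans short).
    by rewrite mulrC ler_wpM2l ?ler0n //; lra.
  apply: (shortB t n s) => //=.
  apply: (le_trans (ltW short)).
  have [_] := @target_coordinates R rd p lambda n hrd.
  set Yn := (_.2)%:~R; set th := lambda * (1 - p).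
  rewrite ler_norml => /andP[Y1 Y2].
  have n8 : 8 <= n%:R * eta.
    rewrite -ler_pdivrMr //; apply: (@le_trans _ _ k1.+1%:R).
      exact/ltW/truncnS_gt.
    by rewrite ler_nat.
  have th1 : 0 <= th <= 1 by rewrite /th; nra.
  pose y := Yn - n%:R * th.
  have -> : Yn = n%:R * th + y by rewrite /y; ring.
  have y1 : -2 <= (2 * a - 1 - delta) * y.
    rewrite /y; move: a01 => /andP[? ?]; nra.
  have h1 : b * n%:R <= (1 + (2 * a - 1) * (1 + th) - (2 * a' - 1)) * n%:R.
    by rewrite ler_wpM2r // ler0n.
  have h2 : delta * n%:R <= eta / 16 * n%:R by rewrite ler_wpM2r ?ler0n.
  have h3 : delta * n%:R * th <= delta * n%:R.
    by case/andP: th1 => ? ?; rewrite ler_piMr // mulr_ge0 ?ler0n // ltW.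
  nra.
have [ae_mu uniq_mu] := hmu.
(* Almost surely the limit mu is incompatible with percolation of the origin, so
   mu + 1 satisfies the defining property of mu vacuously. *)
suff : mu = mu + 1 by lra.
apply: uniq_mu.
have /negligibleS := negligibleU ae_mu negB; apply.
move=> t /= /not_implyP[inf_t _].
have [lt_t|nlt_t] := pselect (distance_limit rd p lambda (X t) mu).
  by right; exact: limB.
by left => /(_ inf_t).
Qed.
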